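(* Let $\Omega$ be a $\sigma$-compact quasi-metric space with Radon measure $\mu$ and let $\Phi$ be a $\mu$-measurable function on $\Omega$. Let $(\mathfrak S,\mathcal B,\nu)$ be a complete $\sigma$-finite separable measure space, and let $X$ be a rearrangement-invariant Banach function space on $\mathfrak S$ with an absolutely continuous norm which is invariant under all automorphisms of $\mathfrak S$. Let $(\tau(u))_{u\in\Omega}$ be a family of automorphisms of $\mathfrak S$ such that the family $(\tau(u)^{-1})_{u\in\Omega}$ is measurable. Then the operator $$(\mathcal H_{\Phi,\tau}f)(x)=\int_\Omega \Phi(u) f(\tau(u)^{-1}(x))\,d\mu(u)$$ is bounded in $X$ provided $\Phi\in L^1(\mu)$, and its norm does not exceed $C_X\|\Phi\|_{L^1(\mu)}$, where the constant $C_X$ depends on $X$ only. Conversely, if this operator is bounded in $X$ and $1\in X$, then $\Phi\in L^1(\mu)$.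
   Context: The measure $\nu$ is positive. An automorphism of the measure space $(\mathfrak S,\mathcal B,\nu)$ is a bijective map $\tau:\mathfrak S\to\mathfrak S$ such that both $\tau$ and $\tau^{-1}$ are measurable and $\nu(\tau(E))=\nu(E)$ for every $E\in\mathcal B$; $\mathrm{Aut}(\mathfrak S)$ is the set of all automorphisms. $\mathrm{Aut}(\mathfrak S)$ is endowed with the smallest sigma-algebra for which all maps $\mathrm{Aut}(\mathfrak S)\to\mathfrak S$, $\tau\mapsto\tau(x)$ ($x\in\mathfrak S$), are measurable. A family $(\tau(u)^{-1})_{u\in\Omega}\subseteq\mathrm{Aut}(\mathfrak S)$ is called measurable if the map $\Omega\to\mathrm{Aut}(\mathfrak S)$, $u\mapsto\tau(u)^{-1}$, is measurable. $X$ is invariant under all automorphisms if $f\in X$ implies $f\circ\tau^{-1}\in X$ for all $\tau\in\mathrm{Aut}(\mathfrak S)$. Rearrangement-invariant Banach function spaces, absolute continuity of the norm and separability of a measure space are in the sense of Bennett–Sharpley, ''Interpolation of Operators'': rearrangement-invariant means that equimeasurable functions have equal norms; the norm is absolutely continuous if $\|f\chi_{E_n}\|_X\to0$ for every $f\in X$ and every sequence of measurable sets $E_n$ with $\chi_{E_n}\to0$ $\nu$-a.e.; a measure space is separable if the sets of finite measure form a separable space for the (pseudo)metric $\nu(E\triangle F)$. The paper assumes throughout that the integral defining $\mathcal H_{\Phi,\tau}f$ exists in the sense of Lebesgue.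
   Formalization: For the boundedness half it is additionally assumed that for each f in X the integrand Φ(u)f(τ(u)^{-1}(x)) is measurable for the completed product of μ and ν (the claim fails without this); ν is assumed not to be the zero measure. *)

(* Defs.v *)
From HB Require Import structures.
From mathcomp Require Import all_boot all_order all_algebra.
From mathcomp Require Import all_classical all_reals all_analysis.
From mathcomp Require Import measurable_realfun complex.

Set Implicit Arguments.
Unset Strict Implicit.
Unset Printing Implicit Defensive.

Import Order.TTheory GRing.Theory Num.Theory.
Import numFieldNormedType.Exports.

Local Open Scope classical_set_scope.
Local Open Scope ring_scope.

(* A topology and a sigma-algebra on the same carrier; nothing relates them
   here, the link is made by [radon_measure] below. *)
#[short(type="topMeasurableType")]
HB.structure Definition TopologicalMeasurable d :=
  {T of Topological T & Measurable d T}.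

Section ComplexFunctions.
Context {d : measure_display} {T : measurableType d} {R : realType}.

Definition cmod (f : T -> R[i]) : T -> \bar R := fun x => (Normc.normc (f x))%:E.

Definition cmeasurable (f : T -> R[i]) : Prop :=
  measurable_fun setT (fun x => complex.Re (f x)) /\
  measurable_fun setT (fun x => complex.Im (f x)).

Definition cintegrable (mu : {measure set T -> \bar R}) (f : T -> R[i]) : Prop :=
  cmeasurable f /\ (\int[mu]_x cmod f x < +oo)%E.

(* An infinite value is allowed: the Lebesgue integral of [g] exists in [-oo, +oo]. *)
Definition integral_exists (mu : {measure set T -> \bar R}) (g : T -> R) : Prop :=
  measurable_fun setT g /\
  ((\int[mu]_x (EFin \o g)^\+ x < +oo)%E \/ (\int[mu]_x (EFin \o g)^\- x < +oo)%E).

Definition cintegral_exists (mu : {measure set T -> \bar R}) (f : T -> R[i]) : Prop :=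
  integral_exists mu (fun x => complex.Re (f x)) /\
  integral_exists mu (fun x => complex.Im (f x)).

Definition cintegral_finite (mu : {measure set T -> \bar R}) (f : T -> R[i]) : Prop :=
  (\int[mu]_x (complex.Re (f x))%:E)%E \is a fin_num /\
  (\int[mu]_x (complex.Im (f x))%:E)%E \is a fin_num.

Definition cintegral (mu : {measure set T -> \bar R}) (f : T -> R[i]) : R[i] :=
  Complex (Rintegral mu setT (fun x => complex.Re (f x)))
          (Rintegral mu setT (fun x => complex.Im (f x))).

End ComplexFunctions.

(* Measurability with respect to the completion of the product measure.  For
   the map (u, x) |-> f (tau(u)^-1 x) this does not follow from the measurability
   of u |-> tau(u)^-1 x for each x. *)
Definition product_cmeasurable d1 d2 (T1 : measurableType d1)
    (T2 : measurableType d2) (R : realType) (mu : {measure set T1 -> \bar R})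
    (nu : {sigma_finite_measure set T2 -> \bar R}) (F : T1 * T2 -> R[i]) : Prop :=
  exists2 G : T1 * T2 -> R[i], cmeasurable G &
    {ae (mu \x nu)%E, forall p, F p = G p}.

Section QuasiMetric.
Context {R : realType} {T : topologicalType}.

Record quasi_metric (rho : T -> T -> R) : Prop := QuasiMetric {
  quasi_metric_ge0 : forall x y, 0 <= rho x y ;
  quasi_metric_eq0 : forall x y, rho x y = 0 <-> x = y ;
  quasi_metric_sym : forall x y, rho x y = rho y x ;
  quasi_metric_triangle : exists K : R,
    forall x y z, rho x y <= K * (rho x z + rho z y) }.

(* The balls of a quasi-metric need not be open. *)
Definition quasi_metric_topology (rho : T -> T -> R) : Prop :=
  forall A : set T, open A <->
    (forall x, A x -> exists2 r : R, 0 < r & [set y | rho x y < r] `<=` A).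

Definition sigma_compact : Prop :=
  exists K : (set T)^nat, (forall n, compact (K n)) /\ \bigcup_n K n = setT.

End QuasiMetric.
Arguments sigma_compact T : clear implicits.

(* The sigma-algebra of [T] is any one that contains the Borel sets and on which
   [mu] is still inner regular: it may be the Borel sigma-algebra or, when [mu]
   is complete, that of all mu-measurable sets. *)
Record radon_measure d (T : topMeasurableType d) (R : realType)
    (mu : {measure set T -> \bar R}) : Prop := RadonMeasure {
  radon_open : forall A : set T, open A -> measurable A ;
  radon_compact : forall K : set T, compact K -> (mu K < +oo)%E ;
  radon_inner : forall A : set T, measurable A ->
    mu A = ereal_sup [set mu K | K in [set K | compact K /\ K `<=` A]] }.

Definition separable_measure d (T : measurableType d) (R : realType)
    (nu : {measure set T -> \bar R}) : Prop :=
  exists E : (set T)^nat,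
    (forall n, measurable (E n) /\ (nu (E n) < +oo)%E) /\
    forall (F : set T) (e : R), measurable F -> (nu F < +oo)%E -> 0 < e ->
      exists n, (nu ((F `\` E n) `|` (E n `\` F)) < e%:E)%E.

Section Automorphisms.
Context {d : measure_display} {T : measurableType d} {R : realType}.
Variable nu : {measure set T -> \bar R}.

Record aut : Type := Aut {
  aut_fun :> T -> T ;
  aut_inv : T -> T ;
  aut_funK : cancel aut_fun aut_inv ;
  aut_invK : cancel aut_inv aut_fun ;
  aut_measurable : measurable_fun setT aut_fun ;
  aut_inv_measurable : measurable_fun setT aut_inv ;
  aut_preserving : forall E, measurable E -> nu (aut_fun @` E) = nu E }.

Lemma aut_inv_image (t : aut) (E : set T) : aut_inv t @` E = t @^-1` E.
Proof.
apply/seteqP; split => [x [y Ey <-] /=|x /= Etx]; first by rewrite aut_invK.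
by exists (t x) => //; rewrite aut_funK.
Qed.

Lemma aut_inv_preserving (t : aut) (E : set T) :
  measurable E -> nu (aut_inv t @` E) = nu E.
Proof.
move=> mE; have mtE : measurable (aut_inv t @` E).
  by rewrite aut_inv_image -[_ @^-1` _]setTI; exact: aut_measurable.
rewrite -(aut_preserving t mtE) image_comp; congr (nu _).
apply/seteqP; split => [x [y Ey <-] /=|x Ex]; first by rewrite aut_invK.
by exists x => //=; rewrite aut_invK.
Qed.

Definition autV (t : aut) : aut :=
  Aut (aut_invK t) (aut_funK t) (aut_inv_measurable t) (aut_measurable t)
      (@aut_inv_preserving t).

Lemma aut_id_preserving (E : set T) : measurable E -> nu (id @` E) = nu E.
Proof. by rewrite image_id. Qed.

Definition aut1 : aut :=
  @Aut id id (fun=> erefl) (fun=> erefl) (@measurable_id _ _ setT)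
    (@measurable_id _ _ setT) aut_id_preserving.

HB.instance Definition _ := gen_eqMixin aut.
HB.instance Definition _ := gen_choiceMixin aut.
HB.instance Definition _ := isPointed.Build aut aut1.

Definition aut_evaluation_preimages : set (set aut) :=
  [set A | exists x : T, exists2 B : set T, measurable B &
     A = [set t : aut | B (t x)]].

Definition measurable_aut := g_sigma_algebraType aut_evaluation_preimages.

End Automorphisms.

Section BanachFunctionSpaces.
Context {d : measure_display} {T : measurableType d} {R : realType}.
Variable nu : {measure set T -> \bar R}.

Definition nonneg_measurable : set (T -> \bar R) :=
  [set f : T -> \bar R | measurable_fun setT f /\ forall x, (0 <= f x)%E].

Local Notation Mplus := nonneg_measurable.

(* Function norms are total here; only their values on [Mplus] matter. *)
Record banach_function_norm (rho : (T -> \bar R) -> \bar R) : Prop := {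
  bfn_ge0 : forall f : T -> \bar R, Mplus f -> (0 <= rho f)%E ;
  bfn_eq0 : forall f : T -> \bar R, Mplus f ->
    (rho f = 0%E <-> {ae nu, forall x, f x = 0%E}) ;
  bfn_scale : forall (a : R) (f : T -> \bar R), 0 <= a -> Mplus f ->
    rho (fun x => a%:E * f x)%E = (a%:E * rho f)%E ;
  bfn_triangle : forall f g : T -> \bar R, Mplus f -> Mplus g ->
    (rho (fun x => f x + g x) <= rho f + rho g)%E ;
  bfn_lattice : forall f g : T -> \bar R, Mplus f -> Mplus g ->
    {ae nu, forall x, (g x <= f x)%E} -> (rho g <= rho f)%E ;
  bfn_fatou : forall (f_ : (T -> \bar R)^nat) (f : T -> \bar R),
    (forall n, Mplus (f_ n)) -> Mplus f ->
    {ae nu, forall x, nondecreasing_seq (f_ ^~ x) /\ f_ n x @[n --> \oo] --> f x} ->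
    rho (f_ n) @[n --> \oo] --> rho f ;
  bfn_indic : forall E, measurable E -> (nu E < +oo)%E ->
    (rho (fun x => (\1_E x)%:E) < +oo)%E ;
  bfn_integral : forall E, measurable E -> (nu E < +oo)%E ->
    exists2 C : R, 0 < C &
      forall f : T -> \bar R, Mplus f -> (\int[nu]_(x in E) f x <= C%:E * rho f)%E }.

Definition equimeasurable (f g : T -> \bar R) : Prop :=
  forall a : R, 0 <= a ->
    nu [set x | (a%:E < f x)%E] = nu [set x | (a%:E < g x)%E].

Definition rearrangement_invariant (rho : (T -> \bar R) -> \bar R) : Prop :=
  forall f g : T -> \bar R, Mplus f -> Mplus g ->
    {ae nu, forall x, (f x < +oo)%E} -> {ae nu, forall x, (g x < +oo)%E} ->
    equimeasurable f g -> rho f = rho g.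

(* The space X(rho); its elements are functions, not classes modulo nu-a.e.
   equality.  Classes of X(rho) always have such finite-valued members. *)
Definition bf_space (rho : (T -> \bar R) -> \bar R) : set (T -> R[i]) :=
  [set f : T -> R[i] | cmeasurable f /\ (rho (cmod f) < +oo)%E].

Definition absolutely_continuous_norm (rho : (T -> \bar R) -> \bar R) : Prop :=
  forall f, bf_space rho f -> forall E : (set T)^nat,
    (forall n, measurable (E n)) ->
    {ae nu, forall x, (\1_(E n) x : R) @[n --> \oo] --> (0 : R)} ->
    rho (cmod (fun x => f x * (\1_(E n) x)%:C%C)) @[n --> \oo] --> 0%E.

Definition aut_invariant (rho : (T -> \bar R) -> \bar R) : Prop :=
  forall (t : aut nu) f, bf_space rho f -> bf_space rho (f \o autV t).

End BanachFunctionSpaces.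

Section Hausdorff.
Context {dO dS : measure_display} {Omega : measurableType dO}
  {S : measurableType dS} {R : realType}.
Variables (mu : {measure set Omega -> \bar R}) (nu : {measure set S -> \bar R}).
Variables (rho : (S -> \bar R) -> \bar R).

Definition hausdorff_integrand (Phi : Omega -> R[i]) (tau : Omega -> aut nu)
    (f : S -> R[i]) (p : Omega * S) : R[i] :=
  Phi p.1 * f (autV (tau p.1) p.2).

Definition hausdorff_op (Phi : Omega -> R[i]) (tau : Omega -> aut nu)
    (f : S -> R[i]) (x : S) : R[i] :=
  cintegral mu (fun u => hausdorff_integrand Phi tau f (u, x)).

Definition hausdorff_defined (Phi : Omega -> R[i]) (tau : Omega -> aut nu) : Prop :=
  forall f, bf_space rho f -> {ae nu, forall x,
    cintegral_exists mu (fun u => hausdorff_integrand Phi tau f (u, x))}.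

(* [Rintegral] replaces an infinite integral by 0, so finiteness nu-a.e. has to be
   stated apart from the membership of [hausdorff_op Phi tau f]. *)
Definition hausdorff_bounded (Phi : Omega -> R[i]) (tau : Omega -> aut nu) : Prop :=
  (forall f, bf_space rho f ->
     {ae nu, forall x,
       cintegral_finite mu (fun u => hausdorff_integrand Phi tau f (u, x))} /\
     bf_space rho (hausdorff_op Phi tau f)) /\
  exists c : R, forall f, bf_space rho f ->
    (rho (cmod (hausdorff_op Phi tau f)) <= c%:E * rho (cmod f))%E.

Definition operator_norm (A : (S -> R[i]) -> (S -> R[i])) : \bar R :=
  ereal_sup [set rho (cmod (A f)) |
    f in [set f : S -> R[i] | bf_space rho f /\ (rho (cmod f) <= 1)%E]].

End Hausdorff.

(* Main.v *)
Require Import Defs.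
From HB Require Import structures.
From mathcomp Require Import all_boot all_order all_algebra.
From mathcomp Require Import all_classical all_reals all_analysis.
From mathcomp Require Import measurable_realfun complex.
From mathcomp Require Import ring lra.

Set Implicit Arguments.
Unset Strict Implicit.
Unset Printing Implicit Defensive.

Import Order.TTheory GRing.Theory Num.Theory.
Import numFieldNormedType.Exports.
Local Open Scope classical_set_scope.
Local Open Scope ring_scope.

(** The analytic content is a Minkowski integral inequality for the function
    norm [rho]: with the weight [|Phi|] and
    [W (u, x) = |f (tau(u)^-1 x)|],

      rho (x |-> int |Phi u| W (u, x) dmu) <= (int |Phi| dmu) * rho |f|,

    because each slice [W (u, .)] is equimeasurable with [|f|] and so has the
    same norm.  This gives the bound with constant 1.

    The Minkowski inequality ([bfn_minkowski]) is proved from the axioms of a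
    function norm alone, without associate spaces.  Normalise the weight to
    mass 1 and let [g] be the weighted mean of the slices.  A convex
    combination of slices has norm at most [c] when all slices do, and the Fatou
    property carries the bound to almost everywhere limits ([bfn_liminf]), so it
    suffices to approximate [g] almost everywhere by averages of finitely many
    slices.  When [W] is bounded and lives over a set of finite measure, such
    averages are chosen greedily: given the error [e] of the previous choices,
    the mean over [u] of [|| e + W(u, .) - g ||_2 ^ 2] is at most
    [|| e ||_2 ^ 2 + V], since the cross term integrates to zero; hence some
    good [u] keeps the squared error below that number, up to slack
    ([exists_improving_sample]).  After [n] steps the squared L2 error of the sum
    is at most [n V], that of the average at most [V / n], and a geometric
    subsequence converges almost everywhere ([fast_L2_cvg_ae]).  General [W] is
    reached by truncation and monotone convergence.

    Tonelli needs [mu] to be sigma-finite.  Quasi-metric balls are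
    neighbourhoods of their centres although they may fail to be open, so the
    topology is Hausdorff, compact sets are closed, hence measurable, and
    sigma-compactness makes a Radon measure sigma-finite
    ([radon_sigma_finite]).  The integrand is only assumed to agree with a
    jointly measurable function off a null set of the product; Tonelli transfers
    this to almost every slice in both directions, and completeness of [nu]
    makes [x |-> H f x] measurable.

    Conversely, [H 1] is the constant [int Phi dmu]; if it is finite at a single
    point, then [Phi] is integrable, and [nu] is not the zero measure. *)

(** * Consequences of the axioms of a function norm *)

Section FunctionNorm.
Context (d : measure_display) (T : measurableType d) (R : realType)
  (nu : {measure set T -> \bar R}) (rho : (T -> \bar R) -> \bar R).
Hypothesis rho_norm : banach_function_norm nu rho.
Local Open Scope ereal_scope.
Implicit Types f g : T -> \bar R.

Lemma bfn_ae_eq f g : nonneg_measurable f -> nonneg_measurable g ->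
  {ae nu, forall x, f x = g x} -> rho f = rho g.
Proof.
move=> Mf Mg fg; apply/eqP; rewrite eq_le; apply/andP; split.
  by apply: (bfn_lattice rho_norm) => //; apply: filterS fg => x ->.
by apply: (bfn_lattice rho_norm) => //; apply: filterS fg => x ->.
Qed.

Lemma nonneg_measurable0 : nonneg_measurable (cst 0 : T -> \bar R).
Proof. by split => //; exact: measurable_cst. Qed.

Lemma bfn0 : rho (cst 0) = 0.
Proof.
by apply/(bfn_eq0 rho_norm nonneg_measurable0); exact: aeW.
Qed.

Lemma nonneg_measurableZ (a : R) f : (0 <= a)%R -> nonneg_measurable f ->
  nonneg_measurable (fun x => a%:E * f x).
Proof.
move=> a0 [mf f0]; split; first exact: emeasurable_funM.
by move=> x; rewrite mule_ge0.
Qed.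

(** Every multiple of the indicator of [{f = +oo}] lies below [f], so this
    indicator has norm 0. *)
Lemma bfn_lty_ae f : nonneg_measurable f -> rho f < +oo ->
  {ae nu, forall x, f x < +oo}.
Proof.
move=> Mf rf; have [mf f0] := Mf.
pose A := [set x | f x = +oo].
have mA : measurable A.
  by rewrite -[A]setTI; exact: (mf measurableT [set +oo] (emeasurable_set1 +oo)).
pose h : T -> \bar R := fun x => (\1_A x)%:E.
have Mh : nonneg_measurable h.
  by split; [apply/measurable_EFinP; exact: measurable_indic|move=> x; rewrite lee_fin].
have rho_h n : n%:R%:E * rho h <= rho f.
  rewrite -(bfn_scale rho_norm)//; apply: (bfn_lattice rho_norm) => //.
    exact: nonneg_measurableZ.
  apply: aeW => x; rewrite /h indicE; have [|_] := boolP (x \in A).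
    by rewrite inE /A /= => ->; rewrite leey.
  by rewrite mule0.
have h0 : rho h = 0.
  apply/eqP; rewrite eq_le (bfn_ge0 rho_norm Mh) andbT.
  have rf_fin : rho f \is a fin_num.
    by rewrite ge0_fin_numE//; exact: (bfn_ge0 rho_norm).
  apply/lee_addgt0Pr => e e0; rewrite add0e.
  pose n := (Num.truncn (fine (rho f) / e)).+1.
  have fn : (fine (rho f) <= n%:R * e)%R.
    by rewrite -ler_pdivrMr//; apply/ltW; exact: truncnS_gt.
  have n0 : 0 < n%:R%:E :> \bar R by rewrite lte_fin ltr0n.
  rewrite -(lee_pmul2l _ n0)//; apply: (le_trans (rho_h n)).
  by rewrite -(fineK rf_fin) -EFinM lee_fin.
have := (bfn_eq0 rho_norm Mh).1 h0; apply: filterS => x.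
rewrite /h indicE ltey => -[] hx; apply/eqP => fx.
by move: hx; rewrite (_ : x \in A) ?inE// => /eqP; rewrite oner_eq0.
Qed.

(** The Fatou axiom speaks of increasing sequences only; it is applied to the tail
    infima of [f_], each of which lies below one of the functions [f_ n]. *)
Lemma bfn_liminf (f_ : (T -> \bar R)^nat) f c :
  (forall n, nonneg_measurable (f_ n)) -> nonneg_measurable f ->
  {ae nu, forall x, f_ n x @[n --> \oo] --> f x} ->
  (forall n, rho (f_ n) <= c) -> rho f <= c.
Proof.
move=> Mf_ Mf cvf rc.
pose b n x := einfs (f_ ^~ x) n.
have Mb n : nonneg_measurable (b n).
  split; first by apply: measurable_fun_einfs => k; exact: (Mf_ k).1.
  by move=> x; apply: le_ereal_inf_tmp => _ [k _ <-]; exact: (Mf_ k).2.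
have b_le n : rho (b n) <= c.
  apply: le_trans (rc n); apply: (bfn_lattice rho_norm) => //.
  by apply: aeW => x; apply: ereal_inf_lbound; exists n => /=.
have cvb : rho (b n) @[n --> \oo] --> rho f.
  apply: (bfn_fatou rho_norm) => //; apply: filterS cvf => x fx; split.
    exact: nondecreasing_einfs.
  exact: cvg_einfs.
rewrite -(cvg_lim _ cvb)//; apply: lime_le; first by apply/cvg_ex; exists (rho f).
exact: nearW.
Qed.

End FunctionNorm.

(** * Means and variances with respect to a weight of mass one *)

Section Variance.
Context (d : measure_display) (O : measurableType d) (R : realType)
  (mu : {measure set O -> \bar R}).
Variable phi : O -> R.
Hypotheses (mphi : measurable_fun setT phi) (phi0 : forall u, 0 <= phi u)
  (phi1 : (\int[mu]_u (phi u)%:E = 1)%E).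

Lemma weight_integrable : mu.-integrable setT (EFin \o phi).
Proof.
apply/integrableP; split; first exact/measurable_EFinP.
by under eq_integral do rewrite /= ger0_norm//; rewrite phi1 ltry.
Qed.

Lemma weight_integrableM (w : O -> R) (k : R) : measurable_fun setT w ->
  (forall u, 0 <= w u <= k) -> mu.-integrable setT (fun u => (phi u * w u)%:E).
Proof.
move=> mw wk.
apply: (le_integrable measurableT _ _ (integrableZl measurableT k weight_integrable)).
  by apply/measurable_EFinP; exact: measurable_funM.
move=> u _ /=; have /andP[w0 wk'] := wk u.
have k0 : 0 <= k by exact: le_trans wk'.
by rewrite lee_fin !ger0_norm ?mulr_ge0// mulrC ler_wpM2r.
Qed.

Lemma weight_mean_bounds (w : O -> R) (k : R) : measurable_fun setT w ->
  (forall u, 0 <= w u <= k) ->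
  0 <= fine (\int[mu]_u (phi u * w u)%:E)%E <= k /\
  (\int[mu]_u (phi u * w u)%:E)%E = (fine (\int[mu]_u (phi u * w u)%:E)%E)%:E.
Proof.
move=> mw wk; set I := (\int[mu]_u _)%E.
have I0 : (0 <= I)%E.
  by apply: integral_ge0 => u _; rewrite lee_fin mulr_ge0//; case/andP: (wk u).
have Ik : (I <= k%:E)%E.
  rewrite -[leRHS]mule1 -phi1 -integralZl//; last exact: weight_integrable.
  apply: le_integral => //; first exact: weight_integrableM wk.
    exact: integrableZl weight_integrable.
  move=> u _; rewrite -EFinM lee_fin mulrC ler_wpM2r//.
  by case/andP: (wk u).
have fI : I \is a fin_num by rewrite ge0_fin_numE// (le_lt_trans Ik)// ltry.
rewrite fineK//; split=> //; rewrite fine_ge0//=.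
by rewrite -lee_fin fineK.
Qed.

(** Expanding the square, the cross term [2 * e * (w - m)] has mean zero, and
    [(w - m) ^+ 2 <= k ^+ 2] because both [w] and [m] lie in [[0, k]]. *)
Lemma weight_variance (w : O -> R) (k e m : R) : measurable_fun setT w ->
  (forall u, 0 <= w u <= k) -> m = fine (\int[mu]_u (phi u * w u)%:E)%E ->
  (\int[mu]_u (phi u * (e + w u - m) ^+ 2)%:E <= (e ^+ 2 + k ^+ 2)%:E)%E.
Proof.
move=> mw wk mE; have [/andP[m0 mk] Im] := weight_mean_bounds mw wk.
rewrite -mE in m0 mk Im.
have k0 : 0 <= k by exact: le_trans mk.
have iphi := weight_integrable.
have iphiw := weight_integrableM mw wk.
(* [phi * (c + 2 * e * w)] dominates the integrand and is affine in [w], so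
   its integral is known exactly. *)
pose c := e ^+ 2 + k ^+ 2 - 2 * e * m.
have -> : (e ^+ 2 + k ^+ 2)%:E =
    (\int[mu]_u (c%:E * (phi u)%:E + (2 * e)%:E * (phi u * w u)%:E))%E.
  rewrite integralD//; [|exact: integrableZl|exact: integrableZl].
  rewrite !integralZl// phi1 Im mule1 -EFinM -EFinD; congr EFin.
  by rewrite /c; ring.
apply: ge0_le_integral => //.
- by move=> u _; rewrite lee_fin mulr_ge0// sqr_ge0.
- apply/measurable_EFinP; apply: measurable_funM => //.
  by apply: measurable_funX; apply: measurable_funB => //; exact: measurable_funD.
- apply: emeasurable_funD; apply: measurable_funeM.
    exact/measurable_EFinP.
  by apply/measurable_EFinP; exact: measurable_funM.
- move=> u _; rewrite -!EFinM -EFinD lee_fin /c.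
  have /andP[w0 wk'] := wk u.
  have H : (w u - m) ^+ 2 <= k ^+ 2 by nra.
  have := phi0 u; nra.
Qed.
End Variance.

(** * Minkowski's integral inequality *)

(** The squared errors have a summable sequence of integrals, so their sum is
    finite almost everywhere and its terms tend to 0. *)
Lemma fast_L2_cvg_ae (d : measure_display) (T : measurableType d) (R : realType)
    (nu : {measure set T -> \bar R}) (b : (T -> R)^nat) (g : T -> R) (V : R) :
  0 <= V -> (forall j, measurable_fun setT (b j)) -> measurable_fun setT g ->
  (forall j, (\int[nu]_x ((b j x - g x) ^+ 2)%:E <= (V / (2 ^ j.+1)%:R)%:E)%E) ->
  {ae nu, forall x, b j x @[j --> \oo] --> g x}.
Proof.
move=> V0 mb mg bg.
pose D j x := ((b j x - g x) ^+ 2)%:E.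
have D0 j x : (0 <= D j x)%E by rewrite lee_fin sqr_ge0.
have mD j : measurable_fun setT (D j).
  by apply/measurable_EFinP; apply: measurable_funX; exact: measurable_funB.
have intD : (\int[nu]_x (\sum_(j <oo) D j x) < +oo)%E.
  rewrite integral_nneseries//; apply: (@le_lt_trans _ _ V%:E); last exact: ltry.
  apply: le_trans (epsilon_trick0 xpredT V0).
  by apply: lee_nneseries => [j _ _|j _]; [exact: integral_ge0|exact: bg].
have : nu.-integrable setT (fun x => \sum_(j <oo) D j x)%E.
  apply/integrableP; split.
    by apply: ge0_emeasurable_sum.
  by under eq_integral do rewrite gee0_abs ?nneseries_ge0//.
move=> /(integrable_ae measurableT); apply: filterS => x /(_ I) fx.
have := nneseries_tail_cvg (f := D ^~ x) (P := xpredT).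
rewrite -ge0_fin_numE ?nneseries_ge0// => /(_ fx (fun k _ => D0 k x)) tail0.
have : D j x @[j --> \oo] --> 0%E.
  apply: (squeeze_cvge _ (@cvg_cst _ _ _ _ _) tail0).
  apply: nearW => j; rewrite D0/=.
  apply: le_trans (nneseries_lim_ge j.+1 (fun n _ _ => D0 n x)).
  by rewrite big_nat1.
move=> /fine_cvg/=.
move=> /(continuous_cvg _ (@sqrt_continuous _ _)); rewrite sqrtr0.
under eq_cvg do rewrite /= sqrtr_sqr.
by move=> /norm_cvg0P/cvg_sub0/(_ (cvg_cst _)).
Qed.

Section Averages.
Context (dO dS : measure_display) (O : measurableType dO)
  (S : measurableType dS) (R : realType)
  (mu : {sigma_finite_measure set O -> \bar R})
  (nu : {sigma_finite_measure set S -> \bar R}).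

Section Bounded.
Variable phi : O -> R.
Hypotheses (mphi : measurable_fun setT phi) (phi0 : forall u, 0 <= phi u)
  (phi1 : (\int[mu]_u (phi u)%:E = 1)%E).
Variables (W : O * S -> R) (E : set S) (k : R).
Hypotheses (mW : measurable_fun setT W) (mE : measurable E)
  (finE : (nu E < +oo)%E) (k0 : 0 <= k)
  (Wk : forall u x, 0 <= W (u, x) <= k * \1_E x).

Let g x : R := fine (\int[mu]_u (phi u * W (u, x))%:E)%E.

Let mphi1 : measurable_fun setT (fun p : O * S => phi p.1).
Proof. exact: measurableT_comp. Qed.

Let mphiW : measurable_fun setT (fun p : O * S => (phi p.1 * W p)%:E).
Proof. by apply/measurable_EFinP; exact: measurable_funM. Qed.

Let phiW0 p : (0 <= (phi p.1 * W p)%:E)%E.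
Proof. by case: p => u x; rewrite lee_fin mulr_ge0//; case/andP: (Wk u x). Qed.

Lemma weighted_mean_measurable : measurable_fun setT g.
Proof.
apply: measurableT_comp => //.
exact: (measurable_fun_fubini_tonelli_G (fun p => (phi p.1 * W p)%:E)).
Qed.
Let mg := weighted_mean_measurable.

Let mWx x : measurable_fun setT (fun u => W (u, x)).
Proof. by apply: measurableT_comp => //; exact: measurable_pair2. Qed.

Let mWu u : measurable_fun setT (fun x => W (u, x)).
Proof. by apply: measurableT_comp => //; exact: measurable_pair1. Qed.

(** By Tonelli and [weight_variance] the weighted mean over [u] of the left-hand
    side is at most [B + k ^+ 2 * fine (nu E)].  The extra 1 is slack: if no good
    [u] satisfied the bound, this mean would be at least one unit larger. *)
Lemma exists_improving_sample (A : set O) (e : S -> R) (B : R) :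
  {ae mu, forall u, 0 < phi u -> A u} -> measurable_fun setT e ->
  (\int[nu]_x ((e x) ^+ 2)%:E <= B%:E)%E ->
  exists2 u, A u &
    (\int[nu]_x ((e x + (W (u, x) - g x)) ^+ 2)%:E
       <= (B + (k ^+ 2 * fine (nu E) + 1))%:E)%E.
Proof.
move=> aeA me eB.
pose D u := (\int[nu]_x ((e x + (W (u, x) - g x)) ^+ 2)%:E)%E.
set V := _ + 1; apply: contrapT => noex.
have D_gt u : A u -> ((B + V)%:E <= D u)%E.
  by move=> Au; rewrite leNgt; apply/negP => Dlt; apply: noex; exists u => //; exact: ltW.
have B0 : 0 <= B.
  by rewrite -lee_fin (le_trans _ eB)// integral_ge0// => x _; rewrite lee_fin sqr_ge0.
have V0 : 0 <= V by rewrite addr_ge0// mulr_ge0// ?sqr_ge0// fine_ge0.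
pose F (p : O * S) := (phi p.1 * (e p.2 + (W p - g p.2)) ^+ 2)%:E.
have mF : measurable_fun setT F.
  apply/measurable_EFinP; apply: measurable_funM => //; apply: measurable_funX.
  apply: measurable_funD; first exact: measurableT_comp.
  by apply: measurable_funB => //; exact: measurableT_comp.
have F0 p : (0 <= F p)%E by rewrite lee_fin mulr_ge0// sqr_ge0.
have phiD u : ((phi u)%:E * D u)%E = (\int[nu]_x F (u, x))%E.
  rewrite /D -ge0_integralZl//.
  - by apply/measurable_EFinP; apply: measurable_funX; apply: measurable_funD => //;
      exact: measurable_funB.
  - by move=> x _; rewrite lee_fin sqr_ge0.
  - by rewrite lee_fin.
have lower : ((B + V)%:E <= \int[mu]_u \int[nu]_x F (u, x))%E.
  rewrite -[leLHS]mule1 -phi1 -ge0_integralZl//; last 3 first.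
  - exact/measurable_EFinP.
  - by move=> u _; rewrite lee_fin.
  - by rewrite lee_fin addr_ge0.
  apply: ae_ge0_le_integral => //.
  - by move=> u _; rewrite -EFinM lee_fin mulr_ge0// addr_ge0.
  - by apply: measurable_funeM; exact/measurable_EFinP.
  - by move=> u _; exact: integral_ge0.
  - exact: measurable_fun_fubini_tonelli_F.
  apply: filterS aeA => u Au _; rewrite -phiD.
  have := phi0 u; rewrite le_eqVlt => /predU1P[<-|phiu].
    by rewrite mule0 mul0e.
  by rewrite muleC lee_pmul2l ?lte_fin//; exact/D_gt/Au.
have upper : (\int[mu]_u \int[nu]_x F (u, x) <= (B + (V - 1))%:E)%E.
  rewrite fubini_tonelli//.
  have finE' : nu E \is a fin_num by rewrite ge0_fin_numE.
  have -> : (B + (V - 1))%:E = (B%:E + \int[nu]_x (k ^+ 2 * \1_E x)%:E)%E.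
    under eq_integral do rewrite EFinM.
    rewrite ge0_integralZl//; last 2 first.
    - by apply/measurable_EFinP; exact: measurable_indic.
    - by rewrite lee_fin sqr_ge0.
    rewrite integral_indic// setIT EFinD; congr (_ + _)%E.
    by rewrite /V addrK EFinM fineK.
  apply: (@le_trans _ _ (\int[nu]_x (((e x) ^+ 2)%:E + (k ^+ 2 * \1_E x)%:E))%E).
    apply: ge0_le_integral => //.
    - by move=> x _; exact: integral_ge0.
    - exact: measurable_fun_fubini_tonelli_G.
    - apply: emeasurable_funD; apply/measurable_EFinP; first exact: measurable_funX.
      by apply: measurable_funM => //; exact: measurable_indic.
    move=> x _; rewrite /F /= -EFinD.
    (* Slices vanish off [E], so the variance bound is used with the constant
       [k * \1_E x], which depends on [x]. *)
    have -> : k ^+ 2 * \1_E x = (k * \1_E x) ^+ 2 :> R.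
      by rewrite exprMn indicE; case: (x \in E); rewrite ?expr1n// expr0n.
    under eq_integral do rewrite addrA.
    exact: (weight_variance mphi phi0 phi1).
  rewrite ge0_integralD//.
  - exact: leeD.
  - by move=> x _; rewrite lee_fin sqr_ge0.
  - by apply/measurable_EFinP; exact: measurable_funX.
  - by move=> x _; rewrite lee_fin mulr_ge0// sqr_ge0.
  - by apply/measurable_EFinP; apply: measurable_funM => //; exact: measurable_indic.
have := le_trans lower upper; rewrite lee_fin; lra.
Qed.

Variable rho : (S -> \bar R) -> \bar R.
Hypothesis rho_norm : banach_function_norm nu rho.
Variable c : R.
Hypothesis W_le : {ae mu, forall u,
  0 < phi u -> (rho (fun x => (W (u, x))%:E) <= c%:E)%E}.

Let V := k ^+ 2 * fine (nu E) + 1.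

(** [a] is a sum of [n] slices, chosen one after the other by
    [exists_improving_sample]. *)
Lemma exists_good_sum n : exists a : S -> R,
  [/\ measurable_fun setT a, forall x, 0 <= a x,
      (rho (EFin \o a) <= (n%:R * c)%:E)%E &
      (\int[nu]_x ((a x - n%:R * g x) ^+ 2)%:E <= (n%:R * V)%:E)%E].
Proof.
elim: n => [|n [a [ma a0 rho_a an]]].
  exists (cst 0); split => //.
  - by rewrite mul0r (_ : EFin \o _ = cst 0%E)// (bfn0 rho_norm).
  - by under eq_integral do rewrite mul0r subr0 expr0n/=; rewrite integral0 mul0r.
have [|u Wu Du] := exists_improving_sample W_le _ an.
  by apply: measurable_funB => //; exact: measurable_funM.
exists (fun x => a x + W (u, x)); split => //.
- exact: measurable_funD.
- by move=> x; rewrite addr_ge0//; case/andP: (Wk u x).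
- rewrite -natr1 mulrDl mul1r EFinD; apply: (le_trans _ (leeD rho_a Wu)).
  apply: (@bfn_triangle _ _ _ _ _ rho_norm (EFin \o a) (fun x => (W (u, x))%:E)).
    by split; [exact/measurable_EFinP|move=> x; rewrite lee_fin].
  split; first exact/measurable_EFinP.
  by move=> x; rewrite lee_fin; case/andP: (Wk u x).
- rewrite -natr1 mulrDl mul1r; apply: le_trans Du; rewrite le_eqVlt; apply/orP; left.
  apply/eqP; apply: eq_integral => x _; congr (_ ^+ 2)%:E.
  by rewrite mulrDl mul1r; ring.
Qed.

(** Averages of [2 ^ j.+1] slices have squared L2 error at most [V / 2 ^ j.+1],
    which is summable. *)
Lemma bounded_weighted_mean_le : (rho (fun x => (g x)%:E) <= c%:E)%E.
Proof.
have [a aP] := choice exists_good_sum.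
pose b j x := (2 ^ j.+1)%:R^-1 * a (2 ^ j.+1)%N x.
have pow0 j : 0 < (2 ^ j.+1)%:R :> R by rewrite ltr0n expn_gt0.
have mb j : measurable_fun setT (b j).
  by have [ma _ _ _] := aP (2 ^ j.+1)%N; exact: measurable_funM.
have V0 : 0 <= V by rewrite addr_ge0// mulr_ge0// ?sqr_ge0// fine_ge0.
have cvb : {ae nu, forall x, b j x @[j --> \oo] --> g x}.
  apply: (fast_L2_cvg_ae V0 mb mg) => j.
  have [ma _ _] := aP (2 ^ j.+1)%N.
  rewrite /b; move: (pow0 j); set n := (2 ^ j.+1)%N => n0 Ha.
  have bE x : ((n%:R^-1 * a n x - g x) ^+ 2)%:E =
      ((n%:R^-1 ^+ 2)%:E * ((a n x - n%:R * g x) ^+ 2)%:E)%E.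
    rewrite -EFinM -exprMn mulrBr mulrA mulVf ?mul1r// gt_eqF//.
  under eq_integral do rewrite bE.
  rewrite ge0_integralZl//; last 2 first.
  - apply/measurable_EFinP; apply: measurable_funX; apply: measurable_funB => //.
    exact: measurable_funM.
  - by move=> x _; rewrite lee_fin sqr_ge0.
  apply: le_trans (lee_wpmul2l _ Ha) _; first by rewrite lee_fin sqr_ge0.
  rewrite -EFinM lee_fin [leLHS](_ : _ = V / n%:R)//.
  by rewrite expr2 mulrA mulfVK ?gt_eqF// mulrC.
apply: (bfn_liminf rho_norm (f_ := fun j x => (b j x)%:E)).
- move=> j; have [ma a0 _ _] := aP (2 ^ j.+1)%N.
  by split; [exact/measurable_EFinP|move=> x; rewrite lee_fin mulr_ge0// invr_ge0 ltW].
- split; first exact/measurable_EFinP.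
  move=> x; rewrite lee_fin; apply: fine_ge0; apply: integral_ge0 => u _.
  exact: (phiW0 (u, x)).
- by apply: filterS cvb => x bx; apply: cvg_EFin => //; exact: nearW.
- move=> j; have [ma a0 Ha _] := aP (2 ^ j.+1)%N.
  move: Ha; rewrite /comp => Ha.
  rewrite (_ : (fun x => _) =
    (fun x => ((2 ^ j.+1)%:R^-1)%:E * (a (2 ^ j.+1)%N x)%:E)%E)//.
  rewrite (bfn_scale rho_norm) ?invr_ge0//; last first.
    by split; [exact/measurable_EFinP|move=> x; rewrite lee_fin].
  apply: le_trans (lee_wpmul2l _ Ha) _; first by rewrite lee_fin invr_ge0 ltW.
  by rewrite -EFinM mulrA mulVf ?mul1r// gt_eqF.
Qed.

End Bounded.

Variable rho : (S -> \bar R) -> \bar R.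
Hypothesis rho_norm : banach_function_norm nu rho.

(** Reduction to the bounded case: cut [W] off at height [n] and restrict it to the
    [n]-th set of an exhaustion of [S] by sets of finite measure. *)
Lemma bfn_weighted_mean (phi : O -> R) (W : O * S -> R) (c : R) :
  measurable_fun setT phi -> (forall u, 0 <= phi u) ->
  (\int[mu]_u (phi u)%:E = 1)%E ->
  measurable_fun setT W -> (forall p, 0 <= W p) ->
  {ae mu, forall u, 0 < phi u -> (rho (fun x => (W (u, x))%:E) <= c%:E)%E} ->
  (rho (fun x => \int[mu]_u (phi u * W (u, x))%:E) <= c%:E)%E.
Proof.
move=> mphi phi0 phi1 mW W0 Wc.
have [F [FT ndF mF]] := (sigma_finiteP _ _).1 (sigma_finiteT nu).
pose Wn n p := Num.min (W p) n%:R * \1_(F n) p.2.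
have Wn_bd n u x : 0 <= Wn n (u, x) <= n%:R * \1_(F n) x.
  by rewrite mulr_ge0 ?le_min ?W0//= ler_wpM2r// ge_min lexx orbT.
have Wn_le n p : Wn n p <= W p.
  rewrite /Wn indicE; case: (p.2 \in F n); last by rewrite mulr0.
  by rewrite mulr1 ge_min lexx.
have mWn n : measurable_fun setT (Wn n).
  apply: measurable_funM; first exact: measurable_minr.
  by apply: measurableT_comp => //; apply: measurable_indic; exact: (mF n).1.
have mWnx n x : measurable_fun setT (fun u => Wn n (u, x)).
  by apply: measurableT_comp => //; exact: measurable_pair2.
have mWu u : measurable_fun setT (fun x => W (u, x)).
  by apply: measurableT_comp => //; exact: measurable_pair1.
have mWnu n u : measurable_fun setT (fun x => Wn n (u, x)).
  by apply: measurableT_comp => //; exact: measurable_pair1.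
have mphiW : measurable_fun setT (fun p : O * S => (phi p.1 * W p)%:E).
  by apply/measurable_EFinP; apply: measurable_funM => //; exact: measurableT_comp.
have phiW0 p : (0 <= (phi p.1 * W p)%:E)%E by rewrite lee_fin mulr_ge0.
have Wn_lex n x u : 0 <= Wn n (u, x) <= n%:R.
  case/andP: (Wn_bd n u x) => -> /le_trans; apply.
  by rewrite -[leRHS]mulr1 ler_wpM2l// indicE; case: (x \in F n).
apply: (bfn_liminf rho_norm
  (f_ := fun n x => (fine (\int[mu]_u (phi u * Wn n (u, x))%:E))%:E)).
- move=> n; split.
    apply/measurable_EFinP.
    exact: (@weighted_mean_measurable phi mphi phi0 (Wn n) (F n) n%:R).
  move=> x; rewrite lee_fin.
  by have [/andP[]] := weight_mean_bounds mphi phi0 phi1 (mWnx n x) (Wn_lex n x).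
- split; first exact: (measurable_fun_fubini_tonelli_G (fun p => (phi p.1 * W p)%:E)).
  by move=> x; apply: integral_ge0 => u _; exact: (phiW0 (u, x)).
- apply: aeW => x.
  under eq_cvg => n.
    rewrite -(weight_mean_bounds mphi phi0 phi1 (mWnx n x) (Wn_lex n x)).2.
    over.
  have -> : (\int[mu]_u (phi u * W (u, x))%:E =
      \int[mu]_u (limn (fun n => (phi u * Wn n (u, x))%:E)))%E.
    apply: eq_integral => u _; apply/esym/cvg_lim => //.
    have [N _ FN] : (\bigcup_n F n) x by rewrite -FT.
    apply: cvg_near_cst; near=> n.
    have -> : Wn n (u, x) = W (u, x).
      rewrite /Wn indicE mem_set/= ?mulr1.
        apply/min_idPl; near: n; exact: nbhs_infty_ger.
      suff : F N `<=` F n by apply.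
      by apply/subsetPset/ndF; near: n; exact: nbhs_infty_ge.
    by [].
  apply: cvg_monotone_convergence => //.
  - by move=> n; apply/measurable_EFinP; exact: measurable_funM.
  - by move=> n u _; rewrite lee_fin mulr_ge0//; case/andP: (Wn_lex n x u).
  - move=> u _ m n mn; rewrite lee_fin ler_wpM2l// /Wn ler_pM//.
    + by rewrite le_min W0 ler0n.
    + by rewrite le_min !ge_min lexx/= ler_nat mn orbT.
    + have /subsetPset FF := ndF _ _ mn.
      rewrite !indicE ler_nat; have [/set_mem xFm|//] := boolP (x \in F m).
      by rewrite mem_set//; exact: FF.
- move=> n; apply: (@bounded_weighted_mean_le phi mphi phi0 phi1 (Wn n) (F n) n%:R) => //.
  + exact: (mF n).1.
  + exact: (mF n).2.
  + apply: filterS Wc => u /[apply]; apply: le_trans.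
    apply: (bfn_lattice rho_norm).
    * by split; [exact/measurable_EFinP|move=> x; rewrite lee_fin].
    * split; first exact/measurable_EFinP.
      by move=> x; rewrite lee_fin; case/andP: (Wn_bd n u x).
    * by apply: aeW => x; rewrite lee_fin.
Unshelve. all: by end_near. Qed.

(** The weight is scaled to mass one.  A weight of mass zero cannot be, but it
    vanishes almost everywhere and so does the mean. *)
Lemma bfn_minkowski (phi : O -> R) (W : O * S -> R) (m c : R) :
  measurable_fun setT phi -> (forall u, 0 <= phi u) ->
  (\int[mu]_u (phi u)%:E = m%:E)%E ->
  measurable_fun setT W -> (forall p, 0 <= W p) ->
  {ae mu, forall u, 0 < phi u -> (rho (fun x => (W (u, x))%:E) <= c%:E)%E} ->
  (rho (fun x => \int[mu]_u (phi u * W (u, x))%:E) <= (m * c)%:E)%E.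
Proof.
move=> mphi phi0 phim mW W0 Wc.
have mWx x : measurable_fun setT (fun u => W (u, x)).
  by apply: measurableT_comp => //; exact: measurable_pair2.
have m0 : 0 <= m by rewrite -lee_fin -phim integral_ge0// => u _; rewrite lee_fin.
have mphiE : measurable_fun setT (EFin \o phi) by exact/measurable_EFinP.
have mphiW : measurable_fun setT (fun p : O * S => (phi p.1 * W p)%:E).
  by apply/measurable_EFinP; apply: measurable_funM => //; exact: measurableT_comp.
have phiW0 p : (0 <= (phi p.1 * W p)%:E)%E by rewrite lee_fin mulr_ge0.
move: m0; rewrite le_eqVlt => /predU1P[m0|m_gt0].
  have phi_ae : ae_eq mu setT (EFin \o phi) (cst 0%E).
    apply/(ae_eq_integral_abs _ measurableT) => //.
    by under eq_integral do rewrite /= ger0_norm//; rewrite phim -m0.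
  rewrite -m0 mul0r (_ : (fun x => _) = cst 0%E) ?(bfn0 rho_norm)//.
  apply/funext => x; rewrite -[RHS](integral0 mu setT); apply: ge0_ae_eq_integral => //.
  - by apply/measurable_EFinP; exact: measurable_funM.
  - by move=> u _; exact: (phiW0 (u, x)).
  - by apply: filterS phi_ae => u /[apply] /= -[->]; rewrite mul0r.
have psi1 : (\int[mu]_u (m^-1 * phi u)%:E = 1)%E.
  under eq_integral do rewrite EFinM.
  rewrite ge0_integralZl//.
  - by rewrite phim -EFinM mulVf ?gt_eqF.
  - by move=> u _; rewrite lee_fin.
  - by rewrite lee_fin invr_ge0 ltW.
pose h x := (\int[mu]_u (m^-1 * phi u * W (u, x))%:E)%E.
have -> : (fun x => \int[mu]_u (phi u * W (u, x))%:E)%E = (fun x => m%:E * h x)%E.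
  apply/funext => x; rewrite /h -ge0_integralZl//.
  - by apply: eq_integral => u _; rewrite -EFinM -!mulrA mulVKf ?gt_eqF.
  - by apply/measurable_EFinP; apply: measurable_funM => //; exact: measurable_funM.
  - by move=> u _; rewrite lee_fin !mulr_ge0// invr_ge0 ltW.
  - by rewrite lee_fin ltW.
have Mh : nonneg_measurable h.
  split; last first.
    by move=> x; apply: integral_ge0 => u _; rewrite lee_fin !mulr_ge0// invr_ge0 ltW.
  apply: (measurable_fun_fubini_tonelli_G (fun p => (m^-1 * phi p.1 * W p)%:E)).
    apply/measurable_EFinP; apply: measurable_funM => //.
    by apply: measurable_funM => //; exact: measurableT_comp.
  by move=> p; rewrite lee_fin !mulr_ge0// invr_ge0 ltW.
rewrite (bfn_scale rho_norm _ Mh) ?(ltW m_gt0)// EFinM.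
apply: lee_wpmul2l; first by rewrite lee_fin ltW.
apply: (@bfn_weighted_mean (fun u => m^-1 * phi u)) => //.
- exact: measurable_funM.
- by move=> u; rewrite mulr_ge0// invr_ge0 ltW.
- apply: filterS Wc => u Wu mphi_u; apply: Wu.
  by rewrite -(pmulr_rgt0 _ (_ : 0 < m^-1)) ?invr_gt0.
Qed.

End Averages.

(** * Quasi-metric spaces and Radon measures *)

Section QuasiMetricSpaces.
Context (R : realType) (T : topologicalType) (dist : T -> T -> R).
Hypotheses (qm : quasi_metric dist) (qmT : quasi_metric_topology dist).

(** A path of [n] jumps from [x] to [z], the first shorter than [s], each bound
    being [q] times smaller than the one before.  Decomposing at the first jump
    suits the triangle inequality, whose constant then multiplies the tail. *)
Fixpoint chain (q : R) (n : nat) (s : R) (x z : T) : Prop :=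
  if n is n'.+1 then
    exists2 y, dist x y < s & chain q n' (s / q) y z
  else x = z.

Lemma chain_rcons q n s x y z :
  chain q n s x y -> dist y z < s / q ^+ n -> chain q n.+1 s x z.
Proof.
elim: n s x => [|n IHn] s x /=; first by move=> ->; rewrite divr1; exists z.
move=> [w xw wy] yz; exists w => //; apply: IHn => //.
by rewrite -mulrA -invfM -exprS.
Qed.

(** With ratio [2 * K] the factor [K] lost at each use of the triangle inequality is
    absorbed, and the bounds on the jumps sum as a geometric series. *)
Lemma dist_chain K n s x z : 1 <= K ->
  (forall x y z, dist x y <= K * (dist x z + dist z y)) -> 0 < s ->
  chain (2 * K) n s x z -> dist x z < 2 * K * s.
Proof.
move=> K1 tri; have K0 : 0 < K by exact: lt_le_trans K1.
elim: n s x => [|n IHn] s x s0 /=.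
  by move=> <-; rewrite (quasi_metric_eq0 qm _ _).2// !mulr_gt0.
move=> [y xy /IHn]; rewrite divr_gt0 ?mulr_gt0// => /(_ isT) yz.
have {}yz : dist y z < s by rewrite mulrCA divff ?mulr1 ?gt_eqF ?mulr_gt0// in yz.
apply: (le_lt_trans (tri x z y)).
by rewrite [2 * K]mulrC -mulrA ltr_pM2l// mulr_natl mulr2n ltrD.
Qed.

Lemma quasi_metric_triangle_ge1 : exists2 K, 1 <= K &
  forall x y z, dist x y <= K * (dist x z + dist z y).
Proof.
have [K tri] := quasi_metric_triangle qm; exists (Num.max K 1).
  by rewrite le_max lexx orbT.
move=> x y z; apply: (le_trans (tri x y z)); rewrite ler_wpM2r//.
  by rewrite addr_ge0//; exact: quasi_metric_ge0 qm _ _.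
by rewrite le_max lexx.
Qed.

(** The points reachable from [x] by chains form an open set: a chain ending at [z]
    can be prolonged by any sufficiently short jump.  This set lies inside the
    ball. *)
Lemma quasi_metric_ball_nbhs x r : 0 < r -> nbhs x [set y | dist x y < r].
Proof.
move=> r0; have [K K1 tri] := quasi_metric_triangle_ge1.
have q0 : 0 < 2 * K by rewrite mulr_gt0// (lt_le_trans _ K1).
pose s := r / (2 * K); have s0 : 0 < s by rewrite divr_gt0.
pose U := [set z | exists n, chain (2 * K) n s x z].
rewrite nbhsE; exists U; last first.
  move=> z [n /(dist_chain K1 tri s0)].
  by rewrite /= /s mulrC divfK// gt_eqF.
split; last by exists 0%N.
apply/qmT => z [n xz]; exists (s / (2 * K) ^+ n); first by rewrite divr_gt0// exprn_gt0.
by move=> y zy; exists n.+1; exact: chain_rcons xz zy.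
Qed.

(** Balls of radius [dist x y / (2 * K)] around distinct points are disjoint. *)
Lemma quasi_metric_hausdorff : hausdorff_space T.
Proof.
move=> x y xy; apply/(quasi_metric_eq0 qm); apply/eqP.
rewrite eq_le (quasi_metric_ge0 qm) andbT leNgt; apply/negP => d0.
have [K K1 tri] := quasi_metric_triangle_ge1.
have q0 : 0 < 2 * K by rewrite mulr_gt0// (lt_le_trans _ K1).
pose r := dist x y / (2 * K); have r0 : 0 < r by rewrite divr_gt0.
have [z [xz yz]] := xy _ _ (quasi_metric_ball_nbhs x r0) (quasi_metric_ball_nbhs y r0).
have := tri x y z; rewrite leNgt => /negP; apply.
rewrite /= in xz yz; rewrite (quasi_metric_sym qm z y).
have -> : dist x y = K * (r + r).
  by rewrite /r; field; rewrite gt_eqF// (lt_le_trans _ K1).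
by rewrite ltr_pM2l ?ltrD// (lt_le_trans _ K1).
Qed.

End QuasiMetricSpaces.

(** In a Hausdorff space the compact sets of an exhaustion are closed, so they
    belong to the sigma-algebra. *)
Lemma radon_sigma_finite (R : realType) (d : measure_display)
    (T : topMeasurableType d) (dist : T -> T -> R)
    (mu : {measure set T -> \bar R}) :
  quasi_metric dist -> quasi_metric_topology dist -> sigma_compact T ->
  radon_measure mu -> sigma_finite setT mu.
Proof.
move=> qm qmT [K [cK KT]] rmu; exists K; first by rewrite KT.
move=> n; split; last exact: (radon_compact rmu).
rewrite -[K n]setCK; apply: measurableC; apply: (radon_open rmu).
apply: closed_openC; apply: compact_closed (cK n); exact: quasi_metric_hausdorff qm qmT.
Qed.

(** * Null sets of a product and complex integrals *)

Section AeProduct.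
Context (d1 d2 : measure_display) (T1 : measurableType d1)
  (T2 : measurableType d2) (R : realType)
  (mu : {sigma_finite_measure set T1 -> \bar R})
  (nu : {sigma_finite_measure set T2 -> \bar R}).

(** Almost all sections of a measurable null set of the product are null, by
    Tonelli applied to its indicator in either order. *)
Lemma ae_product_sections (P : T1 * T2 -> Prop) :
  {ae (mu \x nu)%E, forall p, P p} ->
  {ae mu, forall u, {ae nu, forall x, P (u, x)}} /\
  {ae nu, forall x, {ae mu, forall u, P (u, x)}}.
Proof.
move=> [N [mN N0 subN]].
have PN p : ~ N p -> P p by move=> Np; apply: contrapT => nP; apply/Np/subN.
split.
- have : ae_eq mu setT (nu \o xsection N) (cst 0%E).
    apply/(ae_eq_integral_abs _ measurableT); first exact: measurable_fun_xsection.
    by under eq_integral do rewrite gee0_abs//.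
  apply: filterS => u /(_ I)/= Nu0.
  exists (xsection N u); split => //; first exact: measurable_xsection.
  by move=> x /= nP; rewrite /xsection/= inE; apply: contrapT => /PN.
- have : ae_eq nu setT (mu \o ysection N) (cst 0%E).
    apply/(ae_eq_integral_abs _ measurableT); first exact: measurable_fun_ysection.
    under eq_integral do rewrite gee0_abs//.
    by rewrite -indic_fubini_tonelli_GE// -indic_fubini_tonelli// -indic_fubini_tonelli1//
      integral_indic// setIT.
  apply: filterS => x /(_ I)/= Nx0.
  exists (ysection N x); split => //; first exact: measurable_ysection.
  by move=> u /= nP; rewrite /ysection/= inE; apply: contrapT => /PN.
Qed.
End AeProduct.

Section ComplexFunctions.
Context (d : measure_display) (T : measurableType d) (R : realType).
Implicit Types f g : T -> R[i].

Lemma normc_ge0 (z : R[i]) : 0 <= Normc.normc z.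
Proof. by case: z => a b; exact: sqrtr_ge0. Qed.

Lemma abs_Re_le_normc (z : R[i]) : `|complex.Re z| <= Normc.normc z.
Proof. by case: z => a b /=; rewrite -sqrtr_sqr ler_wsqrtr// lerDl sqr_ge0. Qed.

Lemma abs_Im_le_normc (z : R[i]) : `|complex.Im z| <= Normc.normc z.
Proof. by case: z => a b /=; rewrite -sqrtr_sqr ler_wsqrtr// lerDr sqr_ge0. Qed.

Lemma normc_le_absD (z : R[i]) :
  Normc.normc z <= `|complex.Re z| + `|complex.Im z|.
Proof.
case: z => a b /=; rewrite -[leRHS]ger0_norm ?addr_ge0// -sqrtr_sqr ler_wsqrtr//.
by rewrite sqrrD !real_normK ?num_real// lerD2r lerDl mulrn_wge0// mulr_ge0.
Qed.

(** The Cauchy-Schwarz inequality in the plane. *)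
Lemma dot_le_normc (z w : R[i]) :
  complex.Re z * complex.Re w + complex.Im z * complex.Im w <=
  Normc.normc z * Normc.normc w.
Proof.
case: z w => [a b] [x y] /=; rewrite -sqrtrM ?addr_ge0 ?sqr_ge0//.
apply: (le_trans (ler_norm _)); rewrite -sqrtr_sqr ler_wsqrtr//.
have := sqr_ge0 (a * y - b * x); nra.
Qed.

Lemma sqr_normc (z : R[i]) :
  Normc.normc z ^+ 2 = complex.Re z * complex.Re z + complex.Im z * complex.Im z.
Proof. by case: z => a b /=; rewrite sqr_sqrtr ?addr_ge0 ?sqr_ge0// !expr2. Qed.

Lemma measurable_normc f : cmeasurable f ->
  measurable_fun setT (fun x => Normc.normc (f x)).
Proof.
move=> [mr mi].
have -> : (fun x => Normc.normc (f x)) =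
    Num.sqrt \o (fun x => complex.Re (f x) ^+ 2 + complex.Im (f x) ^+ 2).
  by apply/funext => x /=; case: (f x).
apply: measurableT_comp.
  by apply: continuous_measurable_fun; exact: sqrt_continuous.
by apply: measurable_funD; exact: measurable_funX.
Qed.

Lemma nonneg_measurable_cmod f : cmeasurable f -> nonneg_measurable (cmod f).
Proof.
move=> mf; split; first by apply/measurable_EFinP; exact: measurable_normc.
by move=> x; rewrite lee_fin normc_ge0.
Qed.

Lemma cmeasurableM f g : cmeasurable f -> cmeasurable g ->
  cmeasurable (fun x => f x * g x).
Proof.
move=> [fr fi] [gr gi]; split.
- rewrite (_ : (fun x => _) = (fun x => complex.Re (f x) * complex.Re (g x) -
      complex.Im (f x) * complex.Im (g x))); last first.
    by apply/funext => x; case: (f x) (g x) => [? ?] [? ?].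
  by apply: measurable_funB; exact: measurable_funM.
- rewrite (_ : (fun x => _) = (fun x => complex.Re (f x) * complex.Im (g x) +
      complex.Im (f x) * complex.Re (g x))); last first.
    by apply/funext => x; case: (f x) (g x) => [? ?] [? ?].
  by apply: measurable_funD; exact: measurable_funM.
Qed.

Lemma cmeasurable_comp (d' : measure_display) (T' : measurableType d')
    (h : T' -> T) f : measurable_fun setT h -> cmeasurable f -> cmeasurable (f \o h).
Proof.
by move=> mh [fr fi]; split;
  [exact: (measurableT_comp fr)|exact: (measurableT_comp fi)].
Qed.

Variable mu : {measure set T -> \bar R}.

Lemma integrable_dominated_cmod f (h : T -> R) : cintegrable mu f ->
  measurable_fun setT h -> (forall x, `|h x| <= Normc.normc (f x)) ->
  mu.-integrable setT (EFin \o h).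
Proof.
move=> [mf fi] mh hf; apply/integrableP; split; first exact/measurable_EFinP.
apply: le_lt_trans fi; apply: ge0_le_integral => //.
- by apply: measurableT_comp => //; exact/measurable_EFinP.
- by apply: (nonneg_measurable_cmod mf).1.
- by move=> x _ /=; rewrite lee_fin.
Qed.

Lemma cintegrable_Re f : cintegrable mu f ->
  mu.-integrable setT (EFin \o (fun x => complex.Re (f x))).
Proof.
move=> fi; apply: (integrable_dominated_cmod fi); first exact: fi.1.1.
by move=> x; exact: abs_Re_le_normc.
Qed.

Lemma cintegrable_Im f : cintegrable mu f ->
  mu.-integrable setT (EFin \o (fun x => complex.Im (f x))).
Proof.
move=> fi; apply: (integrable_dominated_cmod fi); first exact: fi.1.2.
by move=> x; exact: abs_Im_le_normc.
Qed.

Lemma cintegrable_exists f : cintegrable mu f -> cintegral_exists mu f.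
Proof.
move=> fi; split; split.
- exact: fi.1.1.
- by left; exact: (integral_funepos_lt_pinfty measurableT (cintegrable_Re fi)).
- exact: fi.1.2.
- by left; exact: (integral_funepos_lt_pinfty measurableT (cintegrable_Im fi)).
Qed.

Lemma cintegrable_finite f : cintegrable mu f -> cintegral_finite mu f.
Proof.
move=> fi; split; apply: integrable_fin_num => //.
- exact: (cintegrable_Re fi).
- exact: (cintegrable_Im fi).
Qed.

(** The integral of a real function is the difference of the integrals of its
    positive and negative parts, with [+oo - +oo = -oo]; it is finite only if both
    are. *)
Lemma cintegral_finite_integrable f : cmeasurable f -> cintegral_finite mu f ->
  cintegrable mu f.
Proof.
move=> mf [fr fi]; split => //; have [mr mi] := mf.
apply: (@le_lt_trans _ _
  (\int[mu]_x (`|(complex.Re (f x))%:E| + `|(complex.Im (f x))%:E|))%E).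
  apply: ge0_le_integral => //.
  - by move=> x _; rewrite lee_fin normc_ge0.
  - by apply: (nonneg_measurable_cmod mf).1.
  - by apply: emeasurable_funD; apply: measurableT_comp => //; exact/measurable_EFinP.
  - by move=> x _; rewrite -EFinD lee_fin normc_le_absD.
rewrite ge0_integralD//; first apply: lte_add_pinfty; rewrite ?integral_fin_num_abs//.
- by apply: measurableT_comp => //; exact/measurable_EFinP.
- by apply: measurableT_comp => //; exact/measurable_EFinP.
Qed.

(** With [z] the integral, [|z| ^ 2] is the integral of the scalar product of [z]
    and [f x], which is at most [|z| * |f x|].  Working with the scalar product
    instead of the real and imaginary parts separately gives the constant 1. *)
Lemma normc_cintegral_le f : cintegrable mu f ->
  ((Normc.normc (cintegral mu f))%:E <= \int[mu]_x cmod f x)%E.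
Proof.
move=> fi; have [mf finf] := fi; set z := cintegral mu f.
have [Mm M0] := nonneg_measurable_cmod mf.
have := normc_ge0 z; rewrite le_eqVlt => /predU1P[<-|z0]; first exact: integral_ge0.
have [iR iI] := (cintegrable_Re fi, cintegrable_Im fi).
have [fR fI] := cintegrable_finite fi.
have z0e : (0 < (Normc.normc z)%:E)%E by rewrite lte_fin.
rewrite -(lee_pmul2l _ z0e)// -EFinM -expr2 sqr_normc.
have -> : (complex.Re z * complex.Re z + complex.Im z * complex.Im z)%:E =
  (\int[mu]_x ((complex.Re z)%:E * (complex.Re (f x))%:E +
               (complex.Im z)%:E * (complex.Im (f x))%:E))%E.
  rewrite integralD//; [|exact: integrableZl|exact: integrableZl].
  by rewrite !integralZl// EFinD !EFinM /z /= !fineK.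
rewrite -ge0_integralZl//; last by rewrite lee_fin ltW.
have iN : mu.-integrable setT (cmod f).
  apply/integrableP; split => //.
  by under eq_integral do rewrite gee0_abs//.
apply: le_integral => //.
- by apply: integrableD => //; exact: integrableZl.
- exact: integrableZl.
- by move=> x _; rewrite -!EFinM -EFinD lee_fin; exact: dot_le_normc.
Qed.

Lemma cintegral_ae_eq f g : cmeasurable f -> cmeasurable g ->
  {ae mu, forall x, f x = g x} -> cintegral mu f = cintegral mu g.
Proof.
move=> [fr fi] [gr gi] fg; congr Complex; congr fine; apply: ae_eq_integral => //.
- exact/measurable_EFinP.
- exact/measurable_EFinP.
- by apply: filterS fg => x /= ->.
- exact/measurable_EFinP.
- exact/measurable_EFinP.
- by apply: filterS fg => x /= ->.
Qed.

Lemma cmeasurable_complete f g : measure_is_complete mu -> cmeasurable f ->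
  {ae mu, forall x, f x = g x} -> cmeasurable g.
Proof.
move=> cmu [fr fi] fg; split; apply/measurable_EFinP.
- apply: (ae_measurable_fun cmu (f := EFin \o (fun x => complex.Re (f x)))).
    by apply: filterS fg => x /= ->.
  exact/measurable_EFinP.
- apply: (ae_measurable_fun cmu (f := EFin \o (fun x => complex.Im (f x)))).
    by apply: filterS fg => x /= ->.
  exact/measurable_EFinP.
Qed.

End ComplexFunctions.

(** * Hausdorff operators *)

Section Hausdorff.
Context (dS : measure_display) (S : measurableType dS) (R : realType)
  (nu : {sigma_finite_measure set S -> \bar R})
  (rho : (S -> \bar R) -> \bar R).

(** Superlevel sets of the two moduli correspond under a measure-preserving
    bijection, so the moduli are equimeasurable. *)
Lemma cmod_comp_aut (t : aut nu) (f : S -> R[i]) :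
  rearrangement_invariant nu rho -> cmeasurable f ->
  rho (cmod (f \o t)) = rho (cmod f).
Proof.
move=> ri mf; have mft := cmeasurable_comp (aut_measurable t) mf.
have [Mf Mft] := (nonneg_measurable_cmod mf, nonneg_measurable_cmod mft).
apply: ri => //; try by apply: aeW => x; exact: ltry.
move=> a a0.
have mA : measurable [set x | (a%:E < cmod f x)%E].
  by rewrite -[X in measurable X]setTI; exact: (emeasurable_fun_o_infty measurableT Mf.1).
rewrite -[in RHS](aut_inv_preserving t mA) aut_inv_image.
by [].
Qed.

Section Operator.
Context (dO : measure_display) (O : measurableType dO)
  (mu : {sigma_finite_measure set O -> \bar R}).

Lemma measurable_Rintegral_section (h : O * S -> R) :
  measurable_fun setT h ->
  measurable_fun setT (fun x => Rintegral mu setT (fun u => h (u, x))).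
Proof.
move=> mh; apply: measurableT_comp => //.
have mhE : measurable_fun setT (EFin \o h) by exact/measurable_EFinP.
rewrite (_ : (fun x => _) = (fun x =>
    \int[mu]_u (EFin \o h)^\+ (u, x) - \int[mu]_u (EFin \o h)^\- (u, x))%E); last first.
  apply/funext => x; rewrite integralE.
  by congr (_ - _)%E; apply: eq_integral => u _; rewrite ?funeposE ?funenegE.
apply: emeasurable_funB.
- apply: (measurable_fun_fubini_tonelli_G (EFin \o h)^\+%E) => //.
  exact: measurable_funepos.
- apply: (measurable_fun_fubini_tonelli_G (EFin \o h)^\-%E) => //.
  exact: measurable_funeneg.
Qed.

Variables (Phi : O -> R[i]) (tau : O -> aut nu).
Hypothesis mPhi : cmeasurable Phi.
Hypothesis mtau : measurable_fun setT (fun u => autV (tau u) : measurable_aut nu).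

Lemma measurable_orbit x : measurable_fun setT (fun u => autV (tau u) x).
Proof.
move=> _ B mB; rewrite setTI.
have := mtau measurableT (Y := [set t : aut nu | B (t x)]); rewrite setTI; apply.
have gen : aut_evaluation_preimages [set t : aut nu | B (t x)] by exists x, B.
exact: (sub_gen_smallest gen).
Qed.

Lemma cmeasurable_integrand f x : cmeasurable f ->
  cmeasurable (fun u => hausdorff_integrand Phi tau f (u, x)).
Proof.
move=> mf; apply: cmeasurableM => //.
exact: (cmeasurable_comp (measurable_orbit x) mf).
Qed.

Hypotheses (nu_complete : measure_is_complete nu)
  (rho_norm : banach_function_norm nu rho)
  (rho_ri : rearrangement_invariant nu rho)
  (iPhi : cintegrable mu Phi).

(** The majorant [M] is the weighted mean of the slices of [|G| / |Phi|], where [G]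
    is the jointly measurable version of the integrand.  Dividing by [|Phi|]
    separates the weight from the slices, and where [Phi] vanishes so does the
    integrand, hence nothing is lost. *)
Lemma hausdorff_integrand_bound f : bf_space rho f ->
  product_cmeasurable mu nu (hausdorff_integrand Phi tau f) ->
  exists M : S -> \bar R, [/\ nonneg_measurable M,
    (rho M <= \int[mu]_u cmod Phi u * rho (cmod f))%E,
    {ae nu, forall x, cintegrable mu (fun u => hausdorff_integrand Phi tau f (u, x)) /\
      (\int[mu]_u cmod (fun u => hausdorff_integrand Phi tau f (u, x)) u <= M x)%E} &
    cmeasurable (hausdorff_op mu Phi tau f)].
Proof.
move=> [mf rf] [G mG FG].
have [FGu FGx] := ae_product_sections FG.
pose phi u : R := Normc.normc (Phi u).
have phi0 u : 0 <= phi u by exact: normc_ge0.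
have mphi : measurable_fun setT phi by exact: measurable_normc.
pose W p : R := Normc.normc (G p) / phi p.1.
have W0 p : 0 <= W p by rewrite divr_ge0// normc_ge0.
have mW : measurable_fun setT W.
  (* The inverse, with [0^-1 = 0], agrees on nonnegative reals with the power -1,
     a measurable function. *)
  have -> : W = (fun p => Normc.normc (G p) * phi p.1 `^ (-1)).
    by apply/funext => p; rewrite powR_inv1.
  apply: measurable_funM; first exact: measurable_normc.
  have mphi1 : measurable_fun setT (fun p : O * S => phi p.1) by exact: measurableT_comp.
  exact: (measurableT_comp (measurable_powR (-1)) mphi1).
have FW u x : hausdorff_integrand Phi tau f (u, x) = G (u, x) ->
    Normc.normc (hausdorff_integrand Phi tau f (u, x)) = phi u * W (u, x).
  move=> E; rewrite /W -E /hausdorff_integrand /= Normc.normcM -/(phi u).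
  by have [->|u0] := eqVneq (phi u) 0; rewrite ?mul0r// [RHS]mulrC divfK.
have phi_fin : (\int[mu]_u (phi u)%:E)%E \is a fin_num.
  rewrite ge0_fin_numE; first exact: iPhi.2.
  by apply: integral_ge0 => u _; rewrite lee_fin.
have rf_fin : rho (cmod f) \is a fin_num.
  by rewrite ge0_fin_numE//; apply: (bfn_ge0 rho_norm); exact: nonneg_measurable_cmod.
have mphiW : measurable_fun setT (fun p : O * S => (phi p.1 * W p)%:E).
  by apply/measurable_EFinP; apply: measurable_funM => //; exact: measurableT_comp.
pose M x := (\int[mu]_u (phi u * W (u, x))%:E)%E.
have MM : nonneg_measurable M.
  split; last by move=> x; apply: integral_ge0 => u _; rewrite lee_fin mulr_ge0.
  apply: (measurable_fun_fubini_tonelli_G (fun p => (phi p.1 * W p)%:E)) => //.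
  by move=> p; rewrite lee_fin mulr_ge0.
have rM : (rho M <= \int[mu]_u cmod Phi u * rho (cmod f))%E.
  rewrite -[X in (X * _)%E](fineK phi_fin) -(fineK rf_fin) -EFinM.
  apply: (bfn_minkowski rho_norm) => //; first by rewrite fineK.
  apply: filterS FGu => u FGu phiu.
  rewrite fineK// -(cmod_comp_aut (autV (tau u)) rho_ri mf).
  rewrite (@bfn_ae_eq _ _ _ _ _ rho_norm _ (cmod (f \o autV (tau u))))//.
  - split; last by move=> x; rewrite lee_fin.
    by apply/measurable_EFinP; apply: measurableT_comp => //; exact: measurable_pair1.
  - apply: nonneg_measurable_cmod; apply: cmeasurable_comp mf; exact: aut_measurable.
  - apply: filterS FGu => x /FW.
    rewrite /hausdorff_integrand Normc.normcM => /mulfI E.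
    by rewrite /cmod /= E// gt_eqF.
have M_fin : {ae nu, forall x, (M x < +oo)%E}.
  apply: (bfn_lty_ae rho_norm) => //; apply: le_lt_trans rM _.
  by rewrite -[X in (X * _)%E](fineK phi_fin) -(fineK rf_fin) -EFinM ltry.
have FM : {ae nu, forall x,
    \int[mu]_u cmod (fun u => hausdorff_integrand Phi tau f (u, x)) u = M x}%E.
  apply: filterS FGx => x FGx; apply: ge0_ae_eq_integral => //.
  - by apply: (nonneg_measurable_cmod _).1; exact: cmeasurable_integrand.
  - exact: (measurableT_comp mphiW (measurable_pair2 x)).
  - by move=> u _; rewrite lee_fin normc_ge0.
  - by move=> u _; rewrite lee_fin mulr_ge0.
  - by apply: filterS FGx => u /FW E _; rewrite /cmod E.
exists M; split => //.
- apply: filterS2 M_fin FM => x Mx FMx; split; last by rewrite FMx.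
  by split; [exact: cmeasurable_integrand|rewrite FMx].
- apply: (cmeasurable_complete (f := fun x => cintegral mu (fun u => G (u, x))) nu_complete).
    split; first exact: (measurable_Rintegral_section mG.1).
    exact: (measurable_Rintegral_section mG.2).
  apply: filterS FGx => x FGx; apply: cintegral_ae_eq.
  + exact: (cmeasurable_comp (measurable_pair2 x) mG).
  + exact: cmeasurable_integrand.
  + by apply: filterS FGx => u ->.
Qed.

End Operator.
End Hausdorff.
Section SigmaFiniteCopy.
Context (d : measure_display) (T : measurableType d) (R : realType)
  (mu : {measure set T -> \bar R}).

(** The proof argument is a key for the structure of sigma-finite measure declared
    below; as a function the copy is convertible to [mu]. *)
Definition sigma_finite_copy (_ : sigma_finite setT mu) : set T -> \bar R := mu.

Variable sf : sigma_finite setT mu.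

HB.instance Definition _ := Measure.on (sigma_finite_copy sf).
HB.instance Definition _ :=
  Measure_isSigmaFinite.Build _ _ _ (sigma_finite_copy sf) sf.

End SigmaFiniteCopy.

Section HausdorffBounds.
Context (dS : measure_display) (S : measurableType dS) (R : realType)
  (nu : {sigma_finite_measure set S -> \bar R})
  (rho : (S -> \bar R) -> \bar R).

Lemma hausdorff_bounded_of_integrable (dO : measure_display) (O : measurableType dO)
    (mu : {sigma_finite_measure set O -> \bar R}) (Phi : O -> R[i]) (tau : O -> aut nu) :
  measure_is_complete nu -> banach_function_norm nu rho ->
  rearrangement_invariant nu rho -> cmeasurable Phi ->
  measurable_fun setT (fun u => autV (tau u) : measurable_aut nu) ->
  (forall f, bf_space rho f ->
     product_cmeasurable mu nu (hausdorff_integrand Phi tau f)) ->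
  cintegrable mu Phi ->
  [/\ hausdorff_defined mu rho Phi tau,
      hausdorff_bounded mu rho Phi tau &
      (operator_norm rho (hausdorff_op mu Phi tau) <= \int[mu]_u cmod Phi u)%E].
Proof.
move=> nu_complete rho_norm rho_ri mPhi mtau pm iPhi.
have P0 : (0 <= \int[mu]_u cmod Phi u)%E.
  by apply: integral_ge0 => u _; rewrite lee_fin normc_ge0.
have Pfin : (\int[mu]_u cmod Phi u)%E \is a fin_num by rewrite ge0_fin_numE// iPhi.2.
have Hnorm f : bf_space rho f ->
    (rho (cmod (hausdorff_op mu Phi tau f)) <= \int[mu]_u cmod Phi u * rho (cmod f))%E.
  move=> Xf; have [M [MM rM intF mH]] :=
    hausdorff_integrand_bound mPhi mtau nu_complete rho_norm rho_ri iPhi Xf (pm f Xf).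
  apply: le_trans rM; apply: (bfn_lattice rho_norm) => //.
    exact: nonneg_measurable_cmod.
  apply: filterS intF => x [iF FM]; apply: le_trans FM.
  exact: (normc_cintegral_le iF).
have ops f (Xf : bf_space rho f) :=
  hausdorff_integrand_bound mPhi mtau nu_complete rho_norm rho_ri iPhi Xf (pm f Xf).
split.
- move=> f Xf; have [M [_ _ intF _]] := ops f Xf.
  by apply: filterS intF => x [iF _]; exact: cintegrable_exists.
- split; last first.
    by exists (fine (\int[mu]_u cmod Phi u)%E) => f Xf; rewrite fineK// Hnorm.
  move=> f Xf; have [M [_ _ intF mH]] := ops f Xf; split.
    by apply: filterS intF => x [iF _]; exact: cintegrable_finite.
  split=> //; apply: (le_lt_trans (Hnorm f Xf)).
  by apply: lte_mul_pinfty => //; case: Xf.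
- apply: ge_ereal_sup => _ [f [Xf f1] <-]; apply: (le_trans (Hnorm f Xf)).
  by rewrite -[leRHS]mule1 lee_wpmul2l.
Qed.

(** The integrand of [H 1] at any point is [Phi], so finiteness of the integral at
    one point suffices; such a point exists because [nu] does not vanish. *)
Lemma integrable_of_hausdorff_bounded (dO : measure_display) (O : measurableType dO)
    (mu : {measure set O -> \bar R}) (Phi : O -> R[i]) (tau : O -> aut nu) :
  (0 < nu setT)%E -> cmeasurable Phi -> bf_space rho (cst 1) ->
  hausdorff_bounded mu rho Phi tau -> cintegrable mu Phi.
Proof.
move=> nu0 mPhi X1 [/(_ _ X1)[fin1 _] _].
apply: cintegral_finite_integrable => //; apply: contrapT => nfin.
have : {ae nu, forall x, False}.
  apply: filterS fin1 => x; rewrite /hausdorff_integrand /=.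
  by under eq_fun do rewrite mulr1.
move=> [N [_ N0 subN]]; move: nu0.
have -> : [set: S] = N by apply/seteqP; split => // x _; apply: subN.
by rewrite N0 ltxx.
Qed.
End HausdorffBounds.

Theorem theorem8 (R : realType) (dS : measure_display) (S : measurableType dS)
    (nu : {sigma_finite_measure set S -> \bar R})
    (rho : (S -> \bar R) -> \bar R)
    (nu_positive : (0 < nu setT)%E)
    (nu_complete : measure_is_complete nu)
    (nu_separable : separable_measure nu)
    (rho_norm : banach_function_norm nu rho)
    (rho_ri : rearrangement_invariant nu rho)
    (rho_ac : absolutely_continuous_norm nu rho)
    (rho_aut : aut_invariant nu rho) :
  exists C_X : R,
    forall (dO : measure_display) (Omega : topMeasurableType dO)
      (dist : Omega -> Omega -> R) (mu : {measure set Omega -> \bar R})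
      (Phi : Omega -> R[i]) (tau : Omega -> aut nu),
    quasi_metric dist -> quasi_metric_topology dist -> sigma_compact Omega ->
    radon_measure mu ->
    cmeasurable Phi ->
    measurable_fun setT (fun u => autV (tau u) : measurable_aut nu) ->
    ((forall f, bf_space rho f ->
        product_cmeasurable mu nu (hausdorff_integrand Phi tau f)) ->
     cintegrable mu Phi ->
     [/\ hausdorff_defined mu rho Phi tau,
         hausdorff_bounded mu rho Phi tau &
         (operator_norm rho (hausdorff_op mu Phi tau)
            <= C_X%:E * \int[mu]_u cmod Phi u)%E])
    /\
    (hausdorff_defined mu rho Phi tau ->
     hausdorff_bounded mu rho Phi tau ->
     bf_space rho (cst 1) ->
     cintegrable mu Phi).
Proof.
exists 1 => dO Omega dist mu Phi tau qm qmT scO rmu mPhi mtau.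
split; last by move=> _ bd X1; exact: integrable_of_hausdorff_bounded bd.
have sf := radon_sigma_finite qm qmT scO rmu.
pose mu1 : {sigma_finite_measure set _ -> \bar R} := sigma_finite_copy sf.
move=> pm iPhi; rewrite mul1e.
exact: (@hausdorff_bounded_of_integrable _ _ _ _ _ _ _ mu1 Phi tau).
Qed.
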